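(* Let $(\nu(i))_{i\ge0}$ be a positive decreasing sequence such that $\sum_{i=0}^{\infty}\sqrt{\nu(i)/(i+1)}<\infty$ and $E((f(X_{i,m})-f(X_i))^2)\le \nu(i)$ for all integers $i,m\ge 0$. For $j\ge0$ put $\overline{\nu}(j)=\sum_{i=j}^{\infty}\sqrt{\nu(i)/(i+1)}$, and let $\mu=\lim_{h\to\infty}E(f(X_h))$ (which exists and is finite under these hypotheses). Let $k\ge1$ and $$p_l=\frac{\overline{\nu}(k2^{l-2})-\overline{\nu}(k2^{l-1})}{2^l\,\overline{\nu}(k)}\ (l\ge2),\qquad p_1=\frac13\Big(1-\sum_{l=2}^\infty p_l\Big),\qquad p_0=2p_1 .$$ Then $E(f_{k,0}+Z_k)=\mu$, $T_k\le 9k$, and $$k\,E(Z_k^2)\le 20\,\big(\overline{\nu}(\lfloor b'(k)/2\rfloor)\big)^2 .$$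
   Context: Setting: $F,F'$ are measurable spaces, $g:F\times F'\to F$ is measurable, $(U_i)_{i\in\mathbb Z}$ are i.i.d. $F'$-valued random variables, $X_0\in F$ is deterministic, and $X_{i+1}=g(X_i,U_i)$ for $i\ge0$. The function $f:F\to\mathbb R$ is measurable and $f(X_i)$ is square-integrable for every $i\ge0$. For $m\in\mathbb Z$, $(X_{i,m})_{i\ge -m}$ is defined by $X_{-m,m}=X_0$ and $X_{i+1,m}=g(X_{i,m},U_i)$ for $i\ge -m$; in particular $X_{i,0}=X_i$ for $i\ge0$. Estimators: for $k\ge1$ fix an integer $0\le b'(k)\le k/2$ and set $$f_{k,l}=\frac1{k-b'(k)}\sum_{i=b'(k)}^{k-1}f(X_{i,k(2^l-1)})\quad(l\ge0).$$ Given a probability distribution $(p_l)_{l\ge0}$ on the non-negative integers with all $p_l>0$, let $N$ be independent of $(U_i)_{i\in\mathbb Z}$ with $\Pr(N=l)=p_l$, and $Z_k=(f_{k,N+1}-f_{k,N})/p_N$. Cost model: simulating $f_{k,l}$ takes expected time $k2^l$, so the expected time $\tau_{k,l}$ to simulate $f_{k,l+1}-f_{k,l}$ satisfies $\tau_{k,l}\le k2^{l+1}+k2^l=3k2^l$. The expected time to simulate $Z_k$ is $T_k=\sum_{l\ge0}p_l\tau_{k,l}$. *)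

(* Defs.v *)
From HB Require Import structures.
From mathcomp Require Import all_boot all_order all_algebra finmap.
From mathcomp Require Import all_classical all_reals all_analysis.

Set Implicit Arguments.
Unset Strict Implicit.
Unset Printing Implicit Defensive.

Import Order.TTheory GRing.Theory Num.Theory.
Import numFieldNormedType.Exports.

Local Open Scope classical_set_scope.
Local Open Scope ring_scope.

Section probability_notions.
Context {d d' : measure_display} {T : measurableType d} {S : measurableType d'}
  {R : realType} {P : probability T R}.

Definition mutually_independent (I : choiceType) (U : I -> {RV P >-> S}) : Prop :=
  forall (J : {fset I}) (B : I -> set S), (forall i, measurable (B i)) ->
    (P (\bigcap_(i in [set` J]) (U i @^-1` B i)) =
     \prod_(i <- J) P (U i @^-1` B i))%E.

Definition identically_distributed (I : Type) (U : I -> {RV P >-> S}) : Prop :=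
  forall (i j : I) (B : set S), measurable B ->
    distribution P (U i) B = distribution P (U j) B.

Definition iid (I : choiceType) (U : I -> {RV P >-> S}) : Prop :=
  mutually_independent U /\ identically_distributed U.

(* The sigma-algebra on T generated by the whole family U. *)
Definition sigma_family (I : Type) (U : I -> {RV P >-> S}) : set (set T) :=
  <<s [set A | exists i, exists2 B, measurable B & A = U i @^-1` B] >>.

Definition independent_of_family (d2 : measure_display) (S2 : measurableType d2)
    (I : Type) (N : {RV P >-> S2}) (U : I -> {RV P >-> S}) : Prop :=
  forall (A : set T) (B : set S2), sigma_family U A -> measurable B ->
    (P (A `&` N @^-1` B) = P A * P (N @^-1` B))%E.

End probability_notions.

Section chain.
Context {d d1 d2 : measure_display} {T : measurableType d}
  {F : measurableType d1} {F' : measurableType d2}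
  {R : realType} {P : probability T R}.
Variables (g : F * F' -> F) (x0 : F) (U : int -> {RV P >-> F'}).

(* chain_from m n is X_{-m+n,m}: the state reached at time -m+n by the chain
   started from x0 at time -m. *)
Fixpoint chain_from (m : int) (n : nat) : T -> F :=
  match n with
  | 0%N => fun=> x0
  | n'.+1 => fun w => g (chain_from m n' w, U (- m + n'%:Z) w)
  end.

(* X_{i,m}; only meaningful for i >= -m, where absz (i + m) = i + m. *)
Definition chain (i m : int) : T -> F := chain_from m (absz (i + m)).

Variables (f : F -> R) (b : nat -> nat).

Definition fkl (k l : nat) : T -> R := fun w =>
  (k - b k)%:R^-1 *
  \sum_(b k <= i < k) f (chain i%:Z (k * (2 ^ l - 1))%:Z w).

Definition Zk (p : nat -> R) (N : {RV P >-> nat}) (k : nat) : T -> R := fun w =>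
  (fkl k (N w).+1 w - fkl k (N w) w) / p (N w).

End chain.

Section weights.
Context {R : realType}.
Variable nu : nat -> R.

Definition nu_term (i : nat) : R := Num.sqrt (nu i / i.+1%:R).

Definition nubar (j : nat) : R :=
  limn (fun n => \sum_(j <= i < n) nu_term i).

Definition p_tail (k l : nat) : R :=
  (nubar (k * 2 ^ (l - 2)) - nubar (k * 2 ^ (l - 1))) / (2 ^+ l * nubar k).

Definition p_one (k : nat) : R :=
  3^-1 * (1 - limn (fun n => \sum_(2 <= l < n) p_tail k l)).

Definition pl (k l : nat) : R :=
  match l with
  | 0%N => 2 * p_one k
  | 1%N => p_one k
  | _ => p_tail k l
  end.

End weights.

Definition positive_distribution {R : realType} (p : nat -> R) : Prop :=
  (forall l, 0 < p l) /\ series p @ \oo --> (1 : R).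

(* Expected time to simulate f_{k,l}. *)
Definition cost {R : realType} (k l : nat) : R := (k * 2 ^ l)%:R.

(* T_k, for tau k l the expected time to simulate f_{k,l+1} - f_{k,l}. *)
Definition expected_time {R : realType} (p : nat -> R) (tau : nat -> nat -> R)
    (k : nat) : \bar R :=
  (\sum_(0 <= l <oo) (p l * tau k l)%:E)%E.

(* Main.v *)
Require Import Defs.
From HB Require Import structures.
From mathcomp Require Import all_boot all_order all_algebra finmap.
From mathcomp Require Import zify ring lra.
From mathcomp Require Import all_classical all_reals all_analysis.
From mathcomp Require Import measurable_realfun.

Set Implicit Arguments.
Unset Strict Implicit.
Unset Printing Implicit Defensive.

Import Order.TTheory GRing.Theory Num.Theory.
Import numFieldNormedType.Exports.
Local Open Scope classical_set_scope.
Local Open Scope ring_scope.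

(** By the i.i.d. assumption the pair [(X_{i,m+r}, X_{i,m})] has the law of
    [(X_{i+m,r}, X_{i+m})], so [nu (i + m)] bounds the mean square of
    [f(X_{i,m+r}) - f(X_{i,m})]. Hence [E f(X_h)] is a Cauchy sequence, and by
    Cauchy-Schwarz the [L^2] norm of [f_{k,l+1} - f_{k,l}] is at most the
    average of [sqrt (nu (i + k (2^l - 1)))] over [b'(k) <= i < k]. Conditioning
    on the independent index [N] turns [E Z_k] into a telescoping series, and
    [E (Z_k^2)] into [sum_l E ((f_{k,l+1} - f_{k,l})^2) / p_l]; as [nu] is
    decreasing, [(n - c) sqrt (nu n) <= sqrt n (nubar c - nubar n)], which with
    the chosen [p_l] makes the tail [l >= 2] of the latter telescope as well. *)

(** * Tail sums of [nu_term] and the decay of [nu] *)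

Section weights.
Variables (R : realType) (nu : nat -> R).
Hypothesis nu_gt0 : forall i, 0 < nu i.
Hypothesis nu_decr : forall i j, (i <= j)%N -> nu j <= nu i.
Hypothesis nu_sum : cvgn (series (nu_term nu)).

Lemma nu_term_gt0 i : 0 < nu_term nu i.
Proof. by rewrite sqrtr_gt0 divr_gt0. Qed.

Lemma cvg_nubar j :
  (fun n => \sum_(j <= i < n) nu_term nu i : R) @ \oo --> nubar nu j.
Proof.
have : cvgn (fun n => \sum_(j <= i < n) nu_term nu i).
  by rewrite is_cvg_series_restrict.
exact.
Qed.
Arguments cvg_nubar : clear implicits.

Lemma nubarE i j : (i <= j)%N ->
  nubar nu i = \sum_(i <= l < j) nu_term nu l + nubar nu j.
Proof.
move=> ij.
have h : \sum_(i <= l < j) nu_term nu l + \sum_(j <= l < n) nu_term nu l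
    @[n --> \oo] --> \sum_(i <= l < j) nu_term nu l + nubar nu j.
  by apply: cvgD; [exact: cvg_cst|exact: cvg_nubar].
suff h' : \sum_(i <= l < n) nu_term nu l @[n --> \oo]
    --> \sum_(i <= l < j) nu_term nu l + nubar nu j.
  exact: (cvg_unique _ (cvg_nubar i) h').
apply: cvg_trans h; apply: near_eq_cvg; near=> n => /=.
rewrite [RHS](@big_cat_nat _ _ _ j)//; near: n; exact: nbhs_infty_ge.
Unshelve. all: by end_near. Qed.

Lemma nubar_ge0 j : 0 <= nubar nu j.
Proof.
apply: (cvgr_to_ge (cvg_nubar j)); near=> n.
by apply: sumr_ge0 => i _; exact/ltW/nu_term_gt0.
Unshelve. all: by end_near. Qed.

Lemma nubar_lt i j : (i < j)%N -> nubar nu j < nubar nu i.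
Proof.
move=> ij; rewrite (nubarE (ltnW ij)) ltrDr big_ltn// ltr_wpDr ?nu_term_gt0//.
by apply: sumr_ge0 => l _; exact/ltW/nu_term_gt0.
Qed.

Lemma nubar_le i j : (i <= j)%N -> nubar nu j <= nubar nu i.
Proof. by rewrite leq_eqVlt => /orP[/eqP->//|/nubar_lt/ltW]. Qed.

Lemma nubar_gt0 j : 0 < nubar nu j.
Proof. exact: le_lt_trans (nubar_ge0 _) (nubar_lt (ltnSn j)). Qed.

(** For [c <= i < n] we have [nu n <= nu i] and [i + 1 <= n], so each of the [n - c] terms of
    [nubar nu c - nubar nu n] is at least [sqrt (nu n / n)]. *)
Lemma sqrt_nu_le c n : (c <= n)%N ->
  (n - c)%:R * Num.sqrt (nu n) <= Num.sqrt n%:R * (nubar nu c - nubar nu n).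
Proof.
move=> cn; rewrite (nubarE cn) addrK mulr_sumr mulr_natl -sumr_const_nat.
apply: ler_sum_nat => i /andP[ci ilt].
rewrite /nu_term -sqrtrM ?ler0n// ler_sqrt ?mulr_ge0 ?divr_ge0 ?(ltW (nu_gt0 _))//.
rewrite mulrCA mulrC -[leLHS]mul1r ler_pM ?(ltW (nu_gt0 _))//.
  by rewrite ler_pdivlMr ?mul1r ?ler_nat.
by apply: nu_decr; exact: ltnW.
Qed.

(** Termwise, [sqrt (nu i) = sqrt (i + 1) * nu_term nu i] with [i + 1 <= n]. Keeping [nu i] instead
    of [nu n] suits level 0, where the indices start at [b]. *)
Lemma sum_sqrt_nu_le c n : (c <= n)%N ->
  \sum_(c <= i < n) Num.sqrt (nu i) <= Num.sqrt n%:R * (nubar nu c - nubar nu n).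
Proof.
move=> cn; rewrite (nubarE cn) addrK mulr_sumr.
apply: ler_sum_nat => i /andP[ci ilt].
rewrite /nu_term -sqrtrM ?ler0n// ler_sqrt ?mulr_ge0 ?divr_ge0 ?(ltW (nu_gt0 _))//.
rewrite mulrCA -[leLHS]mulr1 ler_pM2l//.
by rewrite ler_pdivlMr ?mul1r ?ler_nat.
Qed.

(** Taking [c = 0] in [sqrt_nu_le] gives [sqrt (nu n) <= nubar nu 0 / sqrt n]. *)
Lemma cvg_sqrt_nu : Num.sqrt (nu n) @[n --> \oo] --> 0.
Proof.
have h : nubar nu 0 * Num.sqrt n%:R^-1 @[n --> \oo] --> nubar nu 0 * Num.sqrt 0.
  apply: cvgMl_tmp.
  apply: (@continuous_cvg _ R R _ _ (fun n => n%:R^-1) (@Num.sqrt R)).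
    exact: sqrt_continuous.
  rewrite gtr0_cvgV0; first exact: cvgr_idn.
  by near=> n; rewrite ltr0n; near: n; exact: nbhs_infty_gt.
rewrite sqrtr0 mulr0 in h.
apply: (squeeze_cvgr _ (cvg_cst 0) h).
near=> n; rewrite sqrtr_ge0/=.
have n0 : (0 < n)%N by near: n; exact: nbhs_infty_gt.
have := sqrt_nu_le (leq0n n); rewrite subn0.
have sn : 0 < Num.sqrt n%:R :> R by rewrite sqrtr_gt0 ltr0n.
rewrite -{1}(@sqr_sqrtr _ n%:R)// expr2 -mulrA ler_pM2l// => h1.
rewrite sqrtrV ?ler0n// ler_pdivlMr// mulrC (le_trans h1)//.
by rewrite gerBl nubar_ge0.
Unshelve. all: by end_near. Qed.

(** * The level distribution and the expected cost *)

Section distribution.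
Variables (k : nat) (hk : (0 < k)%N).

Lemma p_tail_gt0 l : (2 <= l)%N -> 0 < p_tail nu k l.
Proof.
move=> l2; rewrite divr_gt0 ?mulr_gt0 ?exprn_gt0 ?nubar_gt0//.
by rewrite subr_gt0 nubar_lt// ltn_pmul2l// ltn_exp2l// ltn_sub2l.
Qed.

(** The factor [2 ^+ l] cancels the one in the denominator of [p_tail], leaving a telescoping sum
    that starts at [nubar nu k]. *)
Lemma sum_scaled_p_tail n :
  \sum_(2 <= l < n.+2) p_tail nu k l * 2 ^+ l =
  1 - nubar nu (k * 2 ^ n) / nubar nu k.
Proof.
elim: n => [|n IHn].
  by rewrite big_geq// expn0 muln1 divff ?subrr// gt_eqF ?nubar_gt0.
rewrite big_nat_recr//= IHn /p_tail !subSS subn0.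
rewrite subn0; field.
by rewrite expf_eq0/= pnatr_eq0/= gt_eqF ?nubar_gt0.
Qed.

Lemma sum_scaled_p_tail_le1 n :
  \sum_(2 <= l < n) p_tail nu k l * 2 ^+ l <= 1.
Proof.
case: n => [|[|n]]; [by rewrite big_geq|by rewrite big_geq|].
by rewrite sum_scaled_p_tail gerBl divr_ge0 ?nubar_ge0.
Qed.

(** Since [2 ^+ l >= 4] for [l >= 2], each weight is at most a quarter of its scaled version, and
    the scaled weights sum to at most 1. *)
Lemma sum_p_tail_le n : \sum_(2 <= l < n) p_tail nu k l <= 4^-1.
Proof.
rewrite -[leRHS]mul1r.
apply: le_trans (ler_wpM2r _ (sum_scaled_p_tail_le1 n)); last by rewrite invr_ge0.
rewrite mulr_suml; apply: ler_sum_nat => -[|[|l]]// _.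
rewrite -mulrA ler_peMr ?(ltW (p_tail_gt0 _))// !exprS.
have : 1 <= 2 ^+ l :> R by rewrite exprn_ege1// ler1n.
by move: (2 ^+ l) => x; lra.
Qed.

Lemma cvg_p_tail : cvgn (fun n => \sum_(2 <= l < n) p_tail nu k l).
Proof.
apply: nondecreasing_is_cvgn.
  apply/nondecreasing_seqP => -[|[|n]]; [by rewrite !big_geq|by rewrite !big_geq|].
  by rewrite [leRHS]big_nat_recr//= lerDl ltW// p_tail_gt0.
by exists 4^-1 => _ [n _ <-]; exact: sum_p_tail_le.
Qed.

(** The tail mass lies between 0 and 1/4. The lower bound serves the divisions by [p_0] and [p_1],
    the upper bound the cost. *)
Lemma p_one_itv : 4^-1 <= p_one nu k <= 3^-1.
Proof.
rewrite /p_one; set s := limn _.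
have s4 : s <= 4^-1.
  by apply: (cvgr_to_le cvg_p_tail); near=> n; exact: sum_p_tail_le.
have s0 : 0 <= s.
  apply: (cvgr_to_ge cvg_p_tail); near=> n; rewrite big_nat_cond sumr_ge0// => i.
  by rewrite andbT => /andP[? _]; exact/ltW/p_tail_gt0.
by apply/andP; split; lra.
Unshelve. all: by end_near. Qed.

Lemma pl_gt0 l : 0 < pl nu k l.
Proof.
have /andP[h _] := p_one_itv.
by case: l => [|[|l]]; rewrite /pl ?p_tail_gt0//; lra.
Qed.

Lemma sum_plE n (F : nat -> R) : \sum_(0 <= l < n.+2) pl nu k l * F l =
  p_one nu k * (2 * F 0%N + F 1%N) + \sum_(2 <= l < n.+2) p_tail nu k l * F l.
Proof.
rewrite (@big_cat_nat _ _ _ 2)//=; congr (_ + _).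
  by rewrite !big_nat_recr//= big_geq// add0r mulrDr mulrA [p_one _ _ * 2]mulrC.
by rewrite !big_nat; apply: eq_bigr => -[|[|l]].
Qed.

Lemma pl_distribution : positive_distribution (pl nu k).
Proof.
split; first exact: pl_gt0.
rewrite -(cvg_shiftn 2).
have h : p_one nu k * (2 * 1 + 1) + \sum_(2 <= l < n.+2) p_tail nu k l
    @[n --> \oo] --> p_one nu k * (2 * 1 + 1)
      + limn (fun n => \sum_(2 <= l < n) p_tail nu k l).
  apply: cvgD; first exact: cvg_cst.
  have := cvg_p_tail; rewrite -(cvg_shiftn 2).
  by under eq_fun do rewrite addn2.
have e : p_one nu k * (2 * 1 + 1) + limn (fun n => \sum_(2 <= l < n) p_tail nu k l) = 1.
  by rewrite /p_one; field.
rewrite e in h; apply: cvg_trans h; apply: near_eq_cvg; apply: nearW => n.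
rewrite /series/= addn2; under [RHS]eq_bigr do rewrite -[pl _ _ _]mulr1.
by rewrite sum_plE; under [in RHS]eq_bigr do rewrite mulr1.
Qed.

(** The cost is at most [3 k] times the sum of [p_l 2^l]. Levels 0 and 1 contribute [4 p_1 <= 4/3]
    to that sum and the others at most 1, so even [7 k] would do. *)
Lemma expected_time_le (tau : nat -> nat -> R) :
  (forall l, 0 <= tau k l <= cost k l.+1 + cost k l) ->
  (expected_time (pl nu k) tau k <= (9 * k%:R)%:E)%E.
Proof.
move=> htau; apply: lime_le.
  apply: is_cvg_nneseries => l _ _; rewrite lee_fin mulr_ge0 ?(ltW (pl_gt0 _))//.
  by have /andP[] := htau l.
(* Enlarging the partial sum to at least two terms lets [sum_plE] split off levels 0 and 1. *)
near=> n; apply: (@le_trans _ _ (\sum_(0 <= l < n.+2) (pl nu k l * tau k l)%:E)).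
  rewrite [leRHS](@big_cat_nat _ _ _ n)//=; last by rewrite (leq_trans (leqnSn _)).
  rewrite leeDl// sume_ge0// => l _; rewrite lee_fin mulr_ge0 ?(ltW (pl_gt0 _))//.
  by have /andP[] := htau l.
rewrite sumEFin lee_fin; apply: (@le_trans _ _ (3 * k%:R *
    \sum_(0 <= l < n.+2) pl nu k l * 2 ^+ l)).
  rewrite mulr_sumr; apply: ler_sum => l _.
  rewrite mulrCA ler_wpM2l ?(ltW (pl_gt0 _))//.
  have /andP[_ h] := htau l; apply: (le_trans h).
  by rewrite /cost expnS !natrM natrX; lra.
rewrite sum_plE.
have /andP[_ h] := p_one_itv; have := sum_scaled_p_tail_le1 n.+2.
set s := \sum_(2 <= l < _) _ => hs.
rewrite mulrAC mulrC [9 * _]mulrC ler_wpM2l// expr0 expr1; lra.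
Unshelve. all: by end_near. Qed.

(** * Bounds on the terms of the second-moment series *)

Variables (b : nat) (hb : (2 * b <= k)%N).

(* Bounds the L^2 norm of f_{k,l+1} - f_{k,l}; see integral_sqr_fkl_sub. *)
Definition mean_sqrt_nu l : R :=
  (k - b)%:R^-1 * \sum_(b <= i < k) Num.sqrt (nu (i + k * (2 ^ l - 1))).

Lemma mean_sqrt_nu_ge0 l : 0 <= mean_sqrt_nu l.
Proof. by rewrite mulr_ge0// sumr_ge0// => i _; exact: sqrtr_ge0. Qed.

Lemma ltn_bk : (b < k)%N.
Proof. by move: hb hk; lia. Qed.

(** This is [sum_sqrt_nu_le] from [b] to [k]; the 4 is the square of [k / (k - b) <= 2]. *)
Lemma mean_sqrt_nu0 :
  k%:R * mean_sqrt_nu 0 ^+ 2 <= 4 * (nubar nu b - nubar nu k) ^+ 2.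
Proof.
have bk := ltnW ltn_bk; have := sum_sqrt_nu_le bk.
rewrite /mean_sqrt_nu expn0 subnn muln0.
under [in X in _ -> X]eq_bigr do rewrite addn0.
set S := \sum_(_ <= _ < _) _; set D := _ - _ => hS.
have S0 : 0 <= S by apply: sumr_ge0 => i _; exact: sqrtr_ge0.
have S2 : S ^+ 2 <= k%:R * D ^+ 2.
  by rewrite -[k%:R]sqr_sqrtr// -exprMn lerXn2r// nnegrE (le_trans S0).
have kb0 : 0 < (k - b)%:R :> R by rewrite ltr0n subn_gt0 ltn_bk.
have k0 : 0 < k%:R :> R by rewrite ltr0n.
have kb : k%:R <= 2 * (k - b)%:R :> R.
  rewrite -natrM ler_nat mulnBr; move: hb; rewrite -[in X in _ -> X](subnK hb); lia.
rewrite exprMn mulrA exprVn -[leLHS]mulrA mulrCA ler_pdivrMl ?exprn_gt0//.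
apply: (le_trans (ler_wpM2l (ltW k0) S2)).
have : 0 <= D ^+ 2 by exact: sqr_ge0.
move: (D ^+ 2) => D2 D20; rewrite !mulrA; apply: ler_wpM2r => //.
rewrite -[k%:R * _]expr2.
rewrite (_ : _ * 4 = (2 * (k - b)%:R) ^+ 2); last by ring.
by rewrite lerXn2r ?nnegrE ?mulr_ge0// ltW.
Qed.

(** Every index in the average is at least [k (2^(l+1) - 1) >= k 2^l]. *)
Lemma mean_sqrt_nuS l : mean_sqrt_nu l.+1 <= Num.sqrt (nu (k * 2 ^ l)).
Proof.
have kb0 : 0 < (k - b)%:R :> R by rewrite ltr0n subn_gt0 ltn_bk.
rewrite ler_pdivrMl// mulr_natl -sumr_const_nat.
apply: ler_sum_nat => i _; rewrite ler_sqrt ?(ltW (nu_gt0 _))//.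
apply: nu_decr; rewrite (leq_trans _ (leq_addl _ _))// leq_mul2l expnS.
have := expn_gt0 2 l; rewrite /=; lia.
Qed.

(** After reducing to [nu k], apply [sqrt_nu_le] from [b./2] to [k]. Since [b./2 <= k / 4], the gap
    is at least [3 k / 4], and [16 / 9] is the square of [4 / 3]. *)
Lemma mean_sqrt_nu1 :
  k%:R * mean_sqrt_nu 1 ^+ 2 <= 16 / 9 * (nubar nu b./2 - nubar nu k) ^+ 2.
Proof.
have bk : (b./2 <= k)%N by move: ltn_bk; lia.
have k0 : 0 < k%:R :> R by rewrite ltr0n.
have h1 : mean_sqrt_nu 1 ^+ 2 <= nu k.
  rewrite -[leRHS]sqr_sqrtr ?(ltW (nu_gt0 _))//.
  rewrite lerXn2r ?nnegrE ?mean_sqrt_nu_ge0//.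
  by rewrite (le_trans (mean_sqrt_nuS _))// expn0 muln1.
apply: (le_trans (ler_wpM2l (ltW k0) h1)).
have := sqrt_nu_le bk; set D := _ - _; set s := Num.sqrt (nu k).
rewrite -[nu k]sqr_sqrtr ?(ltW (nu_gt0 _))// -/s => h.
have kb : 3 * k%:R <= 4 * (k - b./2)%:R :> R.
  by rewrite -!natrM ler_nat; move: hb bk; lia.
have h2 : (3 * k%:R * s) ^+ 2 <= (4 * (Num.sqrt k%:R * D)) ^+ 2.
  have s0 : 0 <= s by exact: sqrtr_ge0.
  have u0 : 0 <= 3 * k%:R * s by rewrite !mulr_ge0// ltW.
  have uv : 3 * k%:R * s <= 4 * (Num.sqrt k%:R * D).
    by apply: (le_trans (ler_wpM2r s0 kb)); rewrite -mulrA ler_pM2l.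
  by rewrite lerXn2r// nnegrE (le_trans u0).
rewrite -(ler_pM2l (_ : 0 < 9 * k%:R)) ?mulr_gt0//.
apply: le_trans (le_trans h2 _).
  by rewrite le_eqVlt; apply/predU1l; ring.
by rewrite !exprMn sqr_sqrtr// le_eqVlt; apply/predU1l; field.
Qed.

(** Apply [sqrt_nu_le] from [k 2^(l-2)] to [k 2^(l-1)]: the difference of [nubar] there is exactly
    the numerator of [p_l]. The second moment is thus bounded by a multiple of [p_l^2], and dividing
    by [p_l] leaves a bound linear in [p_l], which is summable by [sum_scaled_p_tail_le1]. *)
Lemma mean_sqrt_nu_tail l : (2 <= l)%N ->
  k%:R * mean_sqrt_nu l ^+ 2 / p_tail nu k l <=
  8 * nubar nu k ^+ 2 * (p_tail nu k l * 2 ^+ l).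
Proof.
case: l => [|[|l]]// _.
have p0 := @p_tail_gt0 l.+2 isT.
have k0 : 0 < k%:R :> R by rewrite ltr0n.
have B0 := nubar_gt0 k.
have h1 : mean_sqrt_nu l.+2 ^+ 2 <= nu (k * 2 ^ l.+1).
  rewrite -[leRHS]sqr_sqrtr ?(ltW (nu_gt0 _))//.
  by rewrite lerXn2r ?nnegrE ?mean_sqrt_nu_ge0// mean_sqrt_nuS.
rewrite ler_pdivrMr//.
apply: (le_trans (ler_wpM2l (ltW k0) h1)).
have cn : (k * 2 ^ l <= k * 2 ^ l.+1)%N by rewrite leq_mul2l leq_exp2l// leqnSn orbT.
have := sqrt_nu_le cn; set D := _ - _; set s := Num.sqrt (nu _).
rewrite -[nu _]sqr_sqrtr ?(ltW (nu_gt0 _))// -/s => h.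
have x0 : 0 < 2 ^+ l :> R by rewrite exprn_gt0.
have hD : p_tail nu k l.+2 = D / (4 * 2 ^+ l * nubar nu k).
  by rewrite /p_tail !subSS !subn0 !exprS mulrA -natrM.
have h2 : ((k%:R * 2 ^+ l) * s) ^+ 2 <= (2 * k%:R * 2 ^+ l) * D ^+ 2.
  have s0 : 0 <= s by exact: sqrtr_ge0.
  have e : (k * 2 ^ l.+1 - k * 2 ^ l)%:R = k%:R * 2 ^+ l :> R.
    by rewrite -mulnBr expnS mul2n -addnn addnK natrM natrX.
  rewrite e in h.
  have u0 : 0 <= k%:R * 2 ^+ l * s by rewrite !mulr_ge0// ltW.
  have e2 : 2 * k%:R * 2 ^+ l = Num.sqrt (k * 2 ^ l.+1)%:R ^+ 2 :> R.
    by rewrite sqr_sqrtr// natrM natrX exprS; ring.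
  by rewrite e2 -exprMn lerXn2r// nnegrE (le_trans u0).
have h3 : k%:R * 2 ^+ l * s ^+ 2 <= 2 * D ^+ 2.
  rewrite -(ler_pM2l (_ : 0 < k%:R * 2 ^+ l)) ?mulr_gt0//.
  apply: le_trans (le_trans h2 _).
    by rewrite le_eqVlt; apply/predU1l; ring.
  by rewrite le_eqVlt; apply/predU1l; ring.
rewrite hD !exprS -(ler_pM2r x0).
apply: le_trans (le_trans h3 _).
  by rewrite le_eqVlt; apply/predU1l; ring.
rewrite le_eqVlt; apply/predU1l; field.
by rewrite !gt_eqF.
Qed.

(** Write [a = nubar nu b./2] and [B = nubar nu k]. Levels 0 and 1 give at most [8 (a - B)^2] each,
    as [p_0 >= 1/2] and [p_1 >= 1/4], and the tail at most [8 B^2]. The total is below [20 a^2]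
    because [0 <= B <= a]. *)
Lemma sum_mean_sqrt_nu_le n :
  \sum_(0 <= l < n.+2) k%:R * mean_sqrt_nu l ^+ 2 / pl nu k l <=
  20 * nubar nu b./2 ^+ 2.
Proof.
rewrite (@big_cat_nat _ _ _ 2)//=.
rewrite [X in X + _]big_ltn// big_nat1.
have /andP[p1 _] := p_one_itv.
have b2b : (b./2 <= b)%N by lia.
have bk : (b <= k)%N := ltnW ltn_bk.
have A1 := nubar_le b2b; have A2 := nubar_le bk; have B0 := nubar_ge0 k.
have T0 : k%:R * mean_sqrt_nu 0 ^+ 2 / pl nu k 0 <=
    8 * (nubar nu b./2 - nubar nu k) ^+ 2.
  rewrite /pl ler_pdivrMr; last by lra.
  apply: (le_trans mean_sqrt_nu0); set d := nubar nu b./2 - _.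
  have d0 : 0 <= d by rewrite /d; lra.
  have : (nubar nu b - nubar nu k) ^+ 2 <= d ^+ 2.
    by rewrite lerXn2r ?nnegrE// /d; lra.
  have : 0 <= d ^+ 2 by exact: sqr_ge0.
  nra.
have T1 : k%:R * mean_sqrt_nu 1 ^+ 2 / pl nu k 1 <=
    8 * (nubar nu b./2 - nubar nu k) ^+ 2.
  rewrite /pl ler_pdivrMr; last by lra.
  apply: (le_trans mean_sqrt_nu1); set d := nubar nu b./2 - _.
  have : 0 <= d ^+ 2 by exact: sqr_ge0.
  nra.
have T2 : \sum_(2 <= l < n.+2) k%:R * mean_sqrt_nu l ^+ 2 / pl nu k l <=
    8 * nubar nu k ^+ 2.
  apply: (@le_trans _ _ (\sum_(2 <= l < n.+2)
      8 * nubar nu k ^+ 2 * (p_tail nu k l * 2 ^+ l))).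
    by apply: ler_sum_nat => -[|[|l]]// _; exact: mean_sqrt_nu_tail.
  rewrite -mulr_sumr -[leRHS]mulr1 ler_wpM2l ?sum_scaled_p_tail_le1//.
  by rewrite mulr_ge0// sqr_ge0.
apply: (le_trans (lerD (lerD T0 T1) T2)); nra.
Qed.

End distribution.
End weights.

(* The measure structure on a pushforward depends on a proof of measurability
   that unification cannot find, hence the explicit argument. *)
Definition image_measure {d1 d2 : measure_display}
    {T1 : measurableType d1} {T2 : measurableType d2} {R : realType}
    (m : {measure set T1 -> \bar R}) (h : T1 -> T2)
    (mh : measurable_fun setT h) : {measure set T2 -> \bar R} :=
  ltac:(refine (pushforward m h); exact mh).

(** Rectangles form a generating pi-system containing the whole space, so finiteness of the total
    mass suffices for uniqueness. *)
Lemma measure_eq_rectangles {d1 d2 : measure_display}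
  {T1 : measurableType d1} {T2 : measurableType d2} {R : realType}
  (m1 m2 : {measure set (T1 * T2) -> \bar R}) :
  (m1 setT < +oo)%E ->
  (forall A B, measurable A -> measurable B -> m1 (A `*` B) = m2 (A `*` B)) ->
  forall X, measurable X -> m1 X = m2 X.
Proof.
move=> m1oo m12 X mX.
apply: (measure_unique [set A `*` B | A in measurable & B in measurable]
  (fun=> setT)) => //.
- exact: measurable_prod_measurableType.
- move=> _ _ [A1 mA1 [B1 mB1 <-]] [A2 mA2 [B2 mB2 <-]].
  exists (A1 `&` A2); first exact: measurableI.
  by exists (B1 `&` B2); [exact: measurableI|rewrite setXI].
- by move=> _; exists setT => //; exists setT => //; rewrite setXTT.
- by rewrite bigcup_const//; exists 0%N.
- by move=> _ [A mA [B mB <-]]; exact: m12.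
Qed.

(** * Invariance in law of recursions driven by i.i.d. variables *)

Section driven_chain.
Context {d d2 dE : measure_display} {T : measurableType d}
  {F' : measurableType d2} {E : measurableType dE}
  {R : realType} {P : probability T R}.
Variables (U : int -> {RV P >-> F'}) (iidU : iid U).
Variables (G : nat -> E * F' -> E) (e0 : E).
Hypothesis mG : forall n, measurable_fun setT (G n).

(** The step [G n] may depend on the number of steps made, so that a pair of chains with different
    starting times is covered too. *)
Fixpoint driven_chain (a : int) (n : nat) : T -> E :=
  if n is n'.+1 then fun w => G n' (driven_chain a n' w, U (a + n'%:Z) w)
  else fun=> e0.

Lemma measurable_driven_chain a n : measurable_fun setT (driven_chain a n).
Proof.
elim: n => [|n IHn] /=; first exact: measurable_cst.
apply: (measurableT_comp (mG n)); apply/measurable_fun_pair => //.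
Qed.

Lemma measurable_cylinder (J : {fset int}) (B : int -> set F') :
  (forall i, measurable (B i)) ->
  measurable (\bigcap_(j in [set` J]) U j @^-1` B j).
Proof.
move=> mB; apply: fin_bigcap_measurable => // i _.
by rewrite -[X in measurable X]setTI; exact: measurable_funP.
Qed.

(* The induction on n needs independence from the cylinders over the indices
   that the chain has not read yet, as each step consumes one of them. *)
Lemma driven_chain_indep n (a : int) (J : {fset int}) (B : int -> set F') (A : set E) :
  (forall i, measurable (B i)) -> (forall i, (i < n)%N -> a + i%:Z \notin J) ->
  measurable A ->
  (P (driven_chain a n @^-1` A `&` \bigcap_(j in [set` J]) U j @^-1` B j) =
   P (driven_chain 0 n @^-1` A) * P (\bigcap_(j in [set` J]) U j @^-1` B j))%E.
Proof.
have [indU idU] := iidU.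
elim: n a J B A => [|n IHn] a J B A mB aJ mA.
  rewrite /= !preimage_cst; case: ifPn => _; first by rewrite setTI probability_setT mul1e.
  by rewrite set0I measure0 mul0e.
set W := \bigcap_(j in _) _.
have mW : measurable W by exact: measurable_cylinder.
have mp b : measurable_fun setT (fun w => (driven_chain b n w, U (b + n%:Z) w)).
  by apply/measurable_fun_pair => //; exact: measurable_driven_chain.
(* On a rectangle the event for [U (b + n)] can be moved into the cylinder, as its index is not in
   [J']; the induction hypothesis then applies to the enlarged index set. *)
have P_rect (b : int) (J' : {fset int}) (B' : int -> set F') (A' : set E) (C : set F') :
    (forall i, measurable (B' i)) -> (forall i, (i < n.+1)%N -> b + i%:Z \notin J') ->
    measurable A' -> measurable C ->
    (P ((fun w => (driven_chain b n w, U (b + n%:Z) w)) @^-1` (A' `*` C)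
      `&` \bigcap_(j in [set` J']) U j @^-1` B' j) =
    P (driven_chain 0 n @^-1` A') * P (U 0 @^-1` C) *
    P (\bigcap_(j in [set` J']) U j @^-1` B' j))%E.
  move=> mB' bJ' mA' mC.
  pose B1 (j : int) := if j == b + n%:Z then C else B' j.
  pose J1 := ((b + n%:Z)%R |` J')%fset.
  have mB1 j : measurable (B1 j) by rewrite /B1; case: ifP.
  have J'E : \bigcap_(j in [set` J']) U j @^-1` B' j =
      \bigcap_(j in [set` J']) U j @^-1` B1 j.
    apply: eq_bigcapr => j /= jJ'; rewrite /B1; case: eqP => // jE.
    by move: (bJ' n (ltnSn n)); rewrite -jE jJ'.
  have J1E : U (b + n%:Z) @^-1` C `&` \bigcap_(j in [set` J']) U j @^-1` B1 j =
      \bigcap_(j in [set` J1]) U j @^-1` B1 j.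
    rewrite /J1; apply/seteqP; split => [w [Cw JB] j /=|w JB].
      rewrite in_fset1U => /predU1P[->|jJ']; last exact: JB.
      by rewrite /B1 eqxx.
    split; last by move=> j jJ'; apply: JB; rewrite /= in_fset1U jJ' orbT.
    by have := JB (b + n%:Z); rewrite /B1 eqxx; apply; rewrite /= in_fset1U eqxx.
  have bn : b + n%:Z \notin J' by exact: bJ'.
  rewrite J'E (_ : _ `&` _ = driven_chain b n @^-1` A' `&`
      \bigcap_(j in [set` J1]) U j @^-1` B1 j); last first.
    by rewrite -J1E setIA; congr (_ `&` _).
  rewrite IHn//; last first.
    move=> i ilt; rewrite in_fset1U negb_or bJ' ?andbT; last exact: ltnW.
    by apply/eqP => /addrI[] /eqP; rewrite ltn_eqF.
  rewrite -muleA; congr (_ * _)%E.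
  rewrite !indU// big_fsetU1//=; congr (_ * _)%E.
  by rewrite /B1 eqxx; exact: (idU _ 0 C mC).
(* The probability of [W] is needed as a nonnegative real to serve as a scaling factor in
   [mscale]. *)
have [c c0 cE] : exists2 c : R, 0 <= c & P W = c%:E.
  exists (fine (P W)); first by rewrite fine_ge0.
  by rewrite fineK// fin_num_measure.
(* As functions of the event for the pair (state, next input), both sides are measures; agreeing on
   rectangles, they agree on the preimage of [A] by [G n]. *)
have m12 (X : set (E * F')) : measurable X ->
    image_measure (mrestr P mW) (mp a) X =
    mscale (NngNum c0) (image_measure P (mp 0)) X.
  apply: measure_eq_rectangles X.
    by rewrite /= /pushforward /mrestr preimage_setT setTI cE ltry.
  move=> A' C mA' mC; rewrite /= /mscale/= /mrestr /pushforward P_rect// -cE.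
  have := P_rect 0 fset0 (fun=> setT) A' C (fun=> measurableT) (fun i _ => isT) mA' mC.
  by rewrite set_fset0 bigcap_set0 setIT probability_setT mule1 => ->; rewrite muleC.
have mGA : measurable (G n @^-1` A) by rewrite -[X in measurable X]setTI; exact: mG.
by have := m12 _ mGA; rewrite /= /mscale/= /mrestr /pushforward -cE muleC.
Qed.

Lemma law_driven_chain n (a : int) (A : set E) : measurable A ->
  P (driven_chain a n @^-1` A) = P (driven_chain 0 n @^-1` A).
Proof.
move=> mA.
have := @driven_chain_indep n a fset0 (fun=> setT) A (fun=> measurableT) (fun i _ => isT) mA.
by rewrite set_fset0 bigcap_set0 setIT probability_setT mule1.
Qed.

Lemma integral_driven_chain n (a : int) (phi : E -> \bar R) :
  measurable_fun setT phi -> (forall x, 0 <= phi x)%E ->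
  (\int[P]_w phi (driven_chain a n w) = \int[P]_w phi (driven_chain 0 n w))%E.
Proof.
move=> mphi phi0.
have h b := @ge0_integral_pushforward _ _ _ _ _ _ (measurable_driven_chain b n) P
  setT phi measurableT mphi (fun x _ => phi0 x).
have := h a; have := h 0; rewrite !preimage_setT => <- <-.
apply: (@eq_measure_integral _ _ _ _ (image_measure P (measurable_driven_chain 0 n))
  (image_measure P (measurable_driven_chain a n))) => A mA _.
exact: law_driven_chain.
Qed.

Lemma integral_driven_chain_real n (a : int) (phi : E -> R) :
  measurable_fun setT phi ->
  P.-integrable setT (fun w => (phi (driven_chain 0 n w))%:E) ->
  P.-integrable setT (fun w => (phi (driven_chain a n w))%:E) /\
  (\int[P]_w (phi (driven_chain a n w))%:E =
   \int[P]_w (phi (driven_chain 0 n w))%:E)%E.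
Proof.
move=> mphi i0.
have ia : P.-integrable setT (fun w => (phi (driven_chain a n w))%:E).
  apply/integrableP; split.
    by apply/measurable_EFinP; apply: (measurableT_comp mphi); exact: measurable_driven_chain.
  (* Integrability is transferred by the nonnegative case, applied to the absolute value. *)
  rewrite (@integral_driven_chain n a (fun x => `|(phi x)%:E|%E))//; last first.
    by apply: measurableT_comp => //; exact/measurable_EFinP.
  by have /integrableP[] := i0.
split => //.
have mphiE : measurable_fun setT (EFin \o phi) by exact/measurable_EFinP.
have h b ib := @integral_pushforward _ _ _ _ _ _ (measurable_driven_chain b n) P
  setT (EFin \o phi) mphiE ib measurableT.
have := h a ia; have := h 0 i0; rewrite !preimage_setT => <- <-.
apply: (@eq_measure_integral _ _ _ _ (image_measure P (measurable_driven_chain 0 n))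
  (image_measure P (measurable_driven_chain a n))) => A mA _.
exact: law_driven_chain.
Qed.
End driven_chain.

(** * Time shifts of the chain and of pairs of chains *)

Section chain_shift.
Context {d d1 d2 : measure_display} {T : measurableType d}
  {F : measurableType d1} {F' : measurableType d2}
  {R : realType} {P : probability T R}.
Variables (g : F * F' -> F) (mg : measurable_fun setT g) (x0 : F).
Variables (U : int -> {RV P >-> F'}) (iidU : iid U).

(* Runs two copies of the chain, the second of which starts r steps late. *)
Definition pair_step (r n : nat) (p : (F * F) * F') : F * F :=
  (g (p.1.1, p.2), if (r <= n)%N then g (p.1.2, p.2) else p.1.2).

Lemma measurable_pair_step r n : measurable_fun setT (pair_step r n).
Proof.
have m1 : measurable_fun setT (fun p : (F * F) * F' => p.1.1).
  exact: (measurableT_comp measurable_fst measurable_fst).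
have m2 : measurable_fun setT (fun p : (F * F) * F' => p.1.2).
  exact: (measurableT_comp measurable_snd measurable_fst).
apply/measurable_fun_pair.
  apply: (measurableT_comp mg); apply/measurable_fun_pair => //.
case: (r <= n)%N => //.
apply: (measurableT_comp mg); apply/measurable_fun_pair => //.
Qed.

(** As long as [n <= r], the truncated [n - r] is 0 and the second copy rests at [x0]; from then on
    both copies read the same [U (a + n)]. The signs come from [chain_from m] starting at time
    [- m]. *)
Lemma driven_chain_pairE r (a : int) n w :
  driven_chain U (pair_step r) (x0, x0) a n w =
  (chain_from g x0 U (- a) n w, chain_from g x0 U (- a - r%:Z) (n - r) w).
Proof.
elim: n => [|n IHn]; first by rewrite sub0n.
rewrite /= IHn /pair_step /= opprK; congr (_, _).
case: leqP => [rn|nr]; last first.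
  by rewrite (eqP (ltnW nr : n - r == 0)%N) (eqP (nr : n.+1 - r == 0)%N).
rewrite subSn//=; congr (g (_, U _ w)).
by move: rn; lia.
Qed.

(** Both pairs are the state after [i + M + r] steps of the same paired recursion, started at times
    [- (M + r)] and [- r]. *)
Lemma integral_chain_pair (phi : F * F -> \bar R) (i M r : nat) :
  measurable_fun setT phi -> (forall x, 0 <= phi x)%E ->
  (\int[P]_w phi (chain g x0 U i%:Z (M + r)%:Z w, chain g x0 U i%:Z M%:Z w) =
   \int[P]_w phi (chain g x0 U (i + M)%:Z r%:Z w, chain g x0 U (i + M)%:Z 0 w))%E.
Proof.
move=> mphi phi0.
pose Y (a : int) := driven_chain U (pair_step r) (x0, x0) a (i + M + r).
have YE : (fun w => (chain g x0 U i%:Z (M + r)%:Z w, chain g x0 U i%:Z M%:Z w)) =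
    Y (- (M + r)%:Z).
  apply/funext => w; rewrite /Y driven_chain_pairE opprK addnK PoszD addrK.
  by rewrite /chain -!PoszD !absz_nat addnA.
have YE' : (fun w => (chain g x0 U (i + M)%:Z r%:Z w, chain g x0 U (i + M)%:Z 0 w)) =
    Y (- r%:Z).
  apply/funext => w; rewrite /Y driven_chain_pairE opprK addnK subrr.
  by rewrite /chain addr0 -!PoszD !absz_nat.
transitivity (\int[P]_w phi (Y (- (M + r)%:Z)%R w))%E; first by rewrite -YE.
transitivity (\int[P]_w phi (Y (- r%:Z)%R w))%E; last by rewrite -YE'.
rewrite integral_driven_chain//; last exact: measurable_pair_step.
by rewrite [RHS]integral_driven_chain//; exact: measurable_pair_step.
Qed.

(** A single chain is the first component of the pair with delay 0. *)
Lemma integral_chain_shift (f : F -> R) (i M : nat) : measurable_fun setT f ->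
  P.-integrable setT (fun w => (f (chain g x0 U (i + M)%:Z 0 w))%:E) ->
  P.-integrable setT (fun w => (f (chain g x0 U i%:Z M%:Z w))%:E) /\
  (\int[P]_w (f (chain g x0 U i%:Z M%:Z w))%:E =
   \int[P]_w (f (chain g x0 U (i + M)%:Z 0 w))%:E)%E.
Proof.
move=> mf i0.
pose Y (a : int) := driven_chain U (pair_step 0) (x0, x0) a (i + M).
have YE (m : nat) : chain_from g x0 U m%:Z (i + M) = fst \o Y (- m%:Z).
  by apply/funext => w; rewrite /Y /= driven_chain_pairE opprK.
have E0 : chain g x0 U (i + M)%:Z 0 = fst \o Y 0.
  by rewrite -(YE 0%N) /chain addr0 absz_nat.
have EM : chain g x0 U i%:Z M%:Z = fst \o Y (- M%:Z).
  by rewrite -YE /chain -PoszD absz_nat.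
rewrite EM E0; rewrite E0 in i0.
have mf1 : measurable_fun setT (f \o fst : F * F -> R).
  exact: measurableT_comp.
have := integral_driven_chain_real iidU (e0 := (x0, x0)) (measurable_pair_step 0)
  (n := (i + M)%N) (- M%:Z) mf1.
exact.
Qed.

End chain_shift.

(** * Measurability with respect to the driving variables *)

Section driven_sigma_algebra.
Context {d d2 : measure_display} {T : measurableType d} {F' : measurableType d2}
  {R : realType} {P : probability T R}.
Variable U : int -> {RV P >-> F'}.

Definition driving_sets : set (set T) :=
  [set A | exists i, exists2 B, measurable B & A = U i @^-1` B].

(* T with the sigma-algebra generated by U, so that measurability with respect
   to sigma_family U is an instance of measurable_fun. *)
Definition driving_type := g_sigma_algebraType driving_sets.

Lemma driving_measurable {d' : measure_display} {S : measurableType d'}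
    (h : T -> S) :
  measurable_fun (setT : set driving_type) (h : driving_type -> S) ->
  forall B, measurable B -> sigma_family U (h @^-1` B).
Proof. by move=> mh B mB; have := mh measurableT _ mB; rewrite setTI. Qed.

Lemma driving_measurable_fun {d' : measure_display} {S : measurableType d'}
    (h : T -> S) :
  measurable_fun (setT : set driving_type) (h : driving_type -> S) ->
  measurable_fun setT h.
Proof.
move=> mh _ B mB; rewrite setTI.
apply: (smallest_sub _ _ (driving_measurable mh mB)); first exact: sigma_algebra_measurable.
by move=> _ [i [C mC ->]]; rewrite -[X in measurable X]setTI; exact: measurable_funP.
Qed.

Lemma driving_measurable_U i :
  measurable_fun (setT : set driving_type) (U i : driving_type -> F').
Proof.
by move=> _ B mB; rewrite setTI; apply: sub_sigma_algebra; exists i, B.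
Qed.

Section chain.
Context {d1 : measure_display} {F : measurableType d1}.
Variables (g : F * F' -> F) (mg : measurable_fun setT g) (x0 : F).

Lemma driving_measurable_chain_from m n : measurable_fun
  (setT : set driving_type) (chain_from g x0 U m n : driving_type -> F).
Proof.
elim: n => [|n IHn] /=; first exact: measurable_cst.
apply: (measurableT_comp mg); apply/measurable_fun_pair => //.
exact: driving_measurable_U.
Qed.

Lemma driving_measurable_fkl (f : F -> R) b k l : measurable_fun setT f ->
  measurable_fun (setT : set driving_type) (fkl g x0 U f b k l : driving_type -> R).
Proof.
move=> mf; apply: measurable_funM; first exact: measurable_cst.
apply: measurable_sum => i.
by apply: (measurableT_comp mf); exact: driving_measurable_chain_from.
Qed.

End chain.

(** * Conditioning on an independent random level *)

Section independent_index.
Variables (N : {RV P >-> nat}) (indN : independent_of_family N U).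
Variables (p : nat -> R) (pN : forall l, P (N @^-1` [set l]) = (p l)%:E).
Variables (h : nat -> T -> R).
Hypothesis mh : forall l,
  measurable_fun (setT : set driving_type) (h l : driving_type -> R).

Lemma p_ge0 l : 0 <= p l. Proof. by rewrite -lee_fin -pN. Qed.

(** By independence, the law of [(h l, N)] restricted to second coordinate [l] is [p l] times the
    law of [(h l, l)]; the integrals are compared through these two image measures. *)
Lemma integral_independent_level l (phi : R -> \bar R) :
  measurable_fun setT phi -> (forall x, 0 <= phi x)%E ->
  (\int[P]_(w in N @^-1` [set l]) phi (h l w) = (p l)%:E * \int[P]_w phi (h l w))%E.
Proof.
move=> mphi phi0.
have mhl := driving_measurable_fun (mh l).
have m1 : measurable_fun setT (fun w => (h l w, N w)).
  by apply/measurable_fun_pair => //; exact: measurable_funP.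
have m2 : measurable_fun setT (fun w => (h l w, l)).
  by apply/measurable_fun_pair => //; exact: measurable_cst.
pose D : set (R * nat) := setT `*` [set l].
have mD : measurable D by exact: measurableX.
have mphi1 : measurable_fun setT (fun y : R * nat => phi y.1).
  exact: (measurableT_comp mphi measurable_fst).
have mphiD : measurable_fun D (fun y : R * nat => phi y.1) by exact: measurable_funTS.
have := @ge0_integral_pushforward _ _ _ _ _ _ m1 P D _ mD mphiD (fun x _ => phi0 x.1).
rewrite [X in _ = integral _ X _ -> _](_ : _ = N @^-1` [set l]); last first.
  by apply/seteqP; split => w //= [].
move=> <-.
rewrite (@eq_measure_integral _ _ _ _
  (mscale (NngNum (p_ge0 l)) (image_measure P m2)) (image_measure P m1)); last first.
  (* As [A] lies in [D], it is determined by its section [Al] at [l]. *)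
  move=> A mA AD; rewrite /= /mscale/= /pushforward.
  pose Al := [set x | A (x, l)].
  have mAl : measurable Al.
    rewrite -[X in measurable X]setTI.
    have : measurable_fun setT (fun x : R => (x, l)).
      by apply/measurable_fun_pair => //; exact: measurable_cst.
    exact.
  rewrite (_ : _ @^-1` A = h l @^-1` Al `&` N @^-1` [set l]); last first.
    apply/seteqP; split => w /=; last first.
      by move=> [Ax Nl]; rewrite /preimage /= Nl.
    move=> Aw; have [_ Nl] := AD _ Aw.
    have {}Nl : N w = l := Nl.
    by rewrite Nl in Aw; split.
  rewrite indN//; last exact: driving_measurable.
  by rewrite pN muleC.
rewrite ge0_integral_mscale//=; congr (_ * _)%E.
rewrite (@ge0_integral_pushforward _ _ _ _ _ _ m2)//.
by rewrite (_ : _ @^-1` D = setT)//; apply/seteqP; split.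
Qed.

Lemma measurable_level l : measurable (N @^-1` [set l]).
Proof. by rewrite -[X in measurable X]setTI; exact: measurable_funP. Qed.

Lemma trivIset_levels : trivIset setT (fun l => N @^-1` [set l]).
Proof.
by apply/trivIsetP => i j _ _ ij; apply/seteqP; split => w //= [-> /eqP]; rewrite (negbTE ij).
Qed.

Lemma bigcup_levels : \bigcup_l N @^-1` [set l] = setT.
Proof. by apply/seteqP; split => w // _; exists (N w). Qed.

(** The countably many events [N = l] cover the space, and on each of them the function is [phi l]
    composed with [h l]. *)
Lemma measurable_randomized (phi : nat -> R -> R) :
  (forall l, measurable_fun setT (phi l)) ->
  measurable_fun setT (fun w => phi (N w) (h (N w) w)).
Proof.
move=> mphi; rewrite -bigcup_levels; apply/measurable_fun_bigcup.
  exact: measurable_level.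
move=> l; apply: (eq_measurable_fun (phi l \o h l)).
  by move=> w; rewrite inE /= => ->.
apply: measurable_funTS; apply: (measurableT_comp (mphi l)).
exact: driving_measurable_fun.
Qed.

Lemma ge0_integral_randomized (phi : nat -> R -> R) :
  (forall l, measurable_fun setT (phi l)) -> (forall l x, 0 <= phi l x) ->
  (\int[P]_w (phi (N w) (h (N w) w))%:E =
   \sum_(l <oo) (p l)%:E * \int[P]_w (phi l (h l w))%:E)%E.
Proof.
move=> mphi phi0; rewrite -[in LHS]bigcup_levels ge0_integral_bigcup//; last 4 first.
- exact: measurable_level.
- by rewrite bigcup_levels; apply/measurable_EFinP; exact: measurable_randomized.
- by move=> w _; rewrite lee_fin.
- exact: trivIset_levels.
apply: eq_eseriesr => l _.
have mphil : measurable_fun setT (EFin \o phi l) by exact/measurable_EFinP.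
rewrite -[RHS](integral_independent_level l mphil); last first.
  by move=> x; rewrite /= lee_fin.
by apply: eq_integral => w; rewrite inE /= => ->.
Qed.

Lemma integral_randomized (phi : nat -> R -> R) :
  (forall l, measurable_fun setT (phi l)) ->
  P.-integrable setT (fun w => (phi (N w) (h (N w) w))%:E) ->
  (forall l, P.-integrable setT (fun w => (phi l (h l w))%:E)) ->
  (\int[P]_w (phi (N w) (h (N w) w))%:E =
   \sum_(l <oo) (p l)%:E * \int[P]_w (phi l (h l w))%:E)%E.
Proof.
move=> mphi iphi iphil; rewrite -[in LHS]bigcup_levels integral_bigcup//; last 3 first.
- exact: trivIset_levels.
- exact: measurable_level.
- by rewrite bigcup_levels.
apply: eq_eseriesr => l _.
transitivity (\int[P]_(w in N @^-1` [set l]) (phi l (h l w))%:E)%E.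
  by apply: eq_integral => w; rewrite inE /= => ->.
have mphil : measurable_fun setT (EFin \o phi l) by exact/measurable_EFinP.
have posE := funepos_comp (EFin \o phi l) (h l).
have negE := funeneg_comp (EFin \o phi l) (h l).
(* Finiteness of the positive part keeps the difference of the two parts well defined, so that [p l]
   distributes over it. *)
have fin := integrable_pos_fin_num measurableT (iphil l).
rewrite posE in fin.
rewrite integralE [X in (_ * X)%E]integralE posE negE.
have mpos : measurable_fun setT (EFin \o phi l)^\+%E by exact: measurable_funepos.
have mneg : measurable_fun setT (EFin \o phi l)^\-%E by exact: measurable_funeneg.
have := integral_independent_level l mpos (fun x => funepos_ge0 _ x).
have := integral_independent_level l mneg (fun x => funeneg_ge0 _ x).
move=> en ep; rewrite muleBr//.
  by congr (_ - _)%E; [exact: ep|exact: en].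
exact: fin_num_adde_defr.
Qed.

End independent_index.
End driven_sigma_algebra.

(** * A Cauchy criterion and mean-square inequalities *)

Lemma cvg_of_tail_bound {R : realType} (a e : nat -> R) :
  e n @[n --> \oo] --> 0 -> (forall j r, `|a (j + r)%N - a j| <= e j) -> cvgn a.
Proof.
move=> e0 ae; apply/cauchy_cvgP/cauchy_exP => eps eps0.
have /cvgrPdist_lt/(_ _ eps0)[N _ hN] := e0.
exists (a N), N => // n /= Nn; rewrite /ball /= -(subnKC Nn) distrC.
apply: (le_lt_trans (ae _ _)).
by have /= := hN N (leqnn N); rewrite sub0r normrN; apply: le_lt_trans; exact: ler_norm.
Qed.

(** Cauchy-Schwarz with free weights. The weights will be bounds on the [L^2] norms of the
    summands. *)
Lemma sqr_sum_le {R : realFieldType} (I : Type) (r : seq I) (s x : I -> R) :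
  (forall i, 0 < s i) ->
  (\sum_(i <- r) x i) ^+ 2 <= \sum_(i <- r) (\sum_(j <- r) s j) / s i * x i ^+ 2.
Proof.
move=> s0; case: r => [|i0 r']; first by rewrite !big_nil expr0n.
set r := i0 :: r'; set S := \sum_(j <- r) s j; set X := \sum_(i <- r) x i.
have S0 : 0 < S.
  by rewrite /S big_cons ltr_wpDr//; apply: sumr_ge0 => i _; exact: ltW.
(* The weighted variance of x / s, scaled by S ^ 2, is nonnegative. *)
have : 0 <= \sum_(i <- r) s i * (S * (x i / s i) - X) ^+ 2.
  by apply: sumr_ge0 => i _; rewrite mulr_ge0 ?sqr_ge0// ltW.
have -> : \sum_(i <- r) s i * (S * (x i / s i) - X) ^+ 2 =
    S * (\sum_(i <- r) S / s i * x i ^+ 2 - X ^+ 2).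
  transitivity (\sum_(i <- r)
      (S * (S / s i * x i ^+ 2) - 2 * S * X * x i + X ^+ 2 * s i)).
    by apply: eq_bigr => i _; field; rewrite gt_eqF.
  rewrite big_split/= sumrB -!mulr_sumr -/X -/S; ring.
by rewrite pmulr_rge0// subr_ge0.
Qed.

Section second_moments.
Context {d : measure_display} {T : measurableType d} {R : realType}
  {P : probability T R}.

(** A form of Minkowski's inequality: after integrating [sqr_sum_le], the [i]-th term is at most
    [c^2 S s_i], and these sum to [c^2 S^2]. *)
Lemma integral_sqr_sum_le (I : Type) (r : seq I) (c : R) (s : I -> R) (x : I -> T -> R) :
  (forall i, 0 < s i) -> (forall i, measurable_fun setT (x i)) ->
  (forall i, (\int[P]_w (x i w ^+ 2)%:E <= (s i ^+ 2)%:E)%E) ->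
  (\int[P]_w ((c * \sum_(i <- r) x i w) ^+ 2)%:E
    <= ((c * \sum_(i <- r) s i) ^+ 2)%:E)%E.
Proof.
move=> s0 mx xs; set S := \sum_(i <- r) s i.
have S0 : 0 <= S by apply: sumr_ge0 => i _; exact: ltW.
have c0 i : 0 <= c ^+ 2 * (S / s i) by rewrite mulr_ge0 ?sqr_ge0 ?divr_ge0// ltW.
have mx2 i : measurable_fun setT (fun w => (x i w ^+ 2)%:E).
  by apply/measurable_EFinP; exact: measurable_funX.
have mcx i : measurable_fun setT (fun w => ((c ^+ 2 * (S / s i))%:E * (x i w ^+ 2)%:E)%E).
  exact: measurable_funeM.
apply: (@le_trans _ _
    (\int[P]_w (\sum_(i <- r) ((c ^+ 2 * (S / s i))%:E * (x i w ^+ 2)%:E)%E)%E)%E).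
  apply: ge0_le_integral => //.
  - by move=> w _; rewrite lee_fin sqr_ge0.
  - apply/measurable_EFinP/measurable_funX/measurable_funM => //.
    exact: measurable_sum.
  - by apply: emeasurable_sum => i.
  - move=> w _; rewrite (eq_bigr (fun i => (c ^+ 2 * (S / s i * x i w ^+ 2))%:E)).
      rewrite sumEFin -mulr_sumr exprMn lee_fin ler_wpM2l ?sqr_ge0//.
      exact: sqr_sum_le.
    by move=> i _; rewrite -EFinM [in RHS]mulrA.
rewrite ge0_integral_sum//; last first.
  by move=> i w _; rewrite -EFinM lee_fin mulr_ge0// sqr_ge0.
apply: (@le_trans _ _ (\sum_(i <- r) (c ^+ 2 * S * s i)%:E)%E).
  apply: lee_sum => i _; rewrite ge0_integralZl_EFin//; last first.
    by move=> w _; rewrite lee_fin sqr_ge0.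
  apply: (@le_trans _ _ ((c ^+ 2 * (S / s i))%:E * (s i ^+ 2)%:E)%E).
    by rewrite lee_wpmul2l// lee_fin.
  rewrite -EFinM lee_fin le_eqVlt; apply/predU1l; field.
  by rewrite gt_eqF.
by rewrite sumEFin -mulr_sumr lee_fin exprMn -mulrA -expr2.
Qed.

Lemma le1sqr (y : R) : `|y| <= 1 + y ^+ 2.
Proof.
rewrite -real_normK ?num_real//; have := normr_ge0 y; move: `|y| => z z0; nra.
Qed.

(** Domination by [1 + x^2], where the constant is integrable for a probability. *)
Lemma integrable_of_sqr (x : T -> R) : measurable_fun setT x ->
  (\int[P]_w (x w ^+ 2)%:E < +oo)%E -> P.-integrable setT (EFin \o x).
Proof.
move=> mx x2.
have i2 : P.-integrable setT (fun w => (1%:E + (x w ^+ 2)%:E)%E).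
  apply: integrableD => //; first exact: finite_measure_integrable_cst.
  apply/integrableP; split; first by apply/measurable_EFinP; exact: measurable_funX.
  by under eq_integral do rewrite gee0_abs ?lee_fin ?sqr_ge0//.
apply: le_integrable i2 => //; first exact/measurable_EFinP.
move=> w _; rewrite -EFinD /= lee_fin [leRHS]ger0_norm ?le1sqr//.
by rewrite addr_ge0// sqr_ge0.
Qed.

Lemma norm_integral_le (x : T -> R) (s : R) : 0 < s -> measurable_fun setT x ->
  (\int[P]_w (x w ^+ 2)%:E <= (s ^+ 2)%:E)%E ->
  (`|\int[P]_w (x w)%:E| <= s%:E)%E.
Proof.
move=> s0 mx x2.
have mxE : measurable_fun setT (EFin \o x) by exact/measurable_EFinP.
apply: (le_trans (le_abse_integral _ _ mxE)) => //.
(* AM-GM: |x| <= x^2 / (2 s) + s / 2. *)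
have c0 : 0 <= (2 * s)^-1 by rewrite invr_ge0 mulr_ge0// ltW.
apply: (@le_trans _ _ (\int[P]_w (((2 * s)^-1)%:E * (x w ^+ 2)%:E + (s / 2)%:E))%E).
  apply: ge0_le_integral => //.
  - exact: measurableT_comp.
  - apply: emeasurable_funD; last exact: measurable_cst.
    by apply: measurable_funeM; apply/measurable_EFinP; exact: measurable_funX.
  move=> w _; rewrite -EFinM -EFinD /= lee_fin.
  rewrite -[x w ^+ 2]real_normK ?num_real//.
  rewrite -(ler_pM2l (_ : 0 < 2 * s)) ?mulr_gt0//.
  rewrite mulrDr mulVKf ?gt_eqF ?mulr_gt0//.
  have := sqr_ge0 (`|x w| - s); move: `|x w| => z; nra.
rewrite ge0_integralD//; last 3 first.
- by move=> w _; rewrite -EFinM lee_fin mulr_ge0// sqr_ge0.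
- by apply: measurable_funeM; apply/measurable_EFinP; exact: measurable_funX.
- by move=> w _; rewrite lee_fin divr_ge0// ltW.
rewrite ge0_integralZl_EFin//; last 2 first.
- by move=> w _; rewrite lee_fin sqr_ge0.
- by apply/measurable_EFinP; exact: measurable_funX.
rewrite integral_cst//= probability_setT mule1.
apply: (@le_trans _ _ (((2 * s)^-1)%:E * (s ^+ 2)%:E + (s / 2)%:E)%E).
  by rewrite leeD2r// lee_wpmul2l// lee_fin.
rewrite -EFinM -EFinD lee_fin le_eqVlt; apply/predU1l; field.
by rewrite gt_eqF.
Qed.

End second_moments.

(** * Moments of the chain and of the estimators *)

Section estimator.
Context {d d1 d2 : measure_display} {T : measurableType d}
  {F : measurableType d1} {F' : measurableType d2}
  {R : realType} {P : probability T R}.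
Variables (g : F * F' -> F) (mg : measurable_fun setT g).
Variables (U : int -> {RV P >-> F'}) (iidU : iid U) (x0 : F).
Variables (f : F -> R) (mf : measurable_fun setT f).
Hypothesis f_L2 : forall i : nat, f \o chain g x0 U i%:Z 0 \in Lfun P 2%:E.
Variables (nu : nat -> R) (nu_gt0 : forall i, 0 < nu i).
Hypothesis nu_bound : forall i m : nat,
  ('E_P[fun w => ((f (chain g x0 U i%:Z m%:Z w)
                  - f (chain g x0 U i%:Z 0 w)) ^+ 2)%R] <= (nu i)%:E)%E.

Local Notation state i m := (fun w => f (chain g x0 U i%:Z m%:Z w)).

(** Nothing is lost by [fine], since [integrable_state0] makes the integral finite. *)
Definition mean_state (j : nat) : R := fine (\int[P]_w (state j 0 w)%:E)%E.

Lemma measurable_state (i m : nat) : measurable_fun setT (state i m).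
Proof.
apply: (measurableT_comp mf).
by apply: driving_measurable_fun; exact: driving_measurable_chain_from.
Qed.

Lemma integrable_state0 (i : nat) : P.-integrable setT (EFin \o state i 0).
Proof.
by apply/Lfun1_integrable; apply: Lfun_subset12; [exact: fin_num_measure|exact: f_L2].
Qed.

Lemma integrable_state (i m : nat) : P.-integrable setT (EFin \o state i m).
Proof. exact: (integral_chain_shift mg iidU mf (integrable_state0 (i + m))).1. Qed.

Lemma integral_state (i m : nat) :
  (\int[P]_w (state i m w)%:E = (mean_state (i + m))%:E)%E.
Proof.
rewrite (integral_chain_shift mg iidU mf (integrable_state0 (i + m))).2 fineK//.
exact: integrable_fin_num (integrable_state0 _).
Qed.

(** Shifting the pair by [m] turns the second chain into the one started at time 0, where [nu_bound]
    applies at index [i + m]. *)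
Lemma integral_sqr_state_sub (i m r : nat) :
  (\int[P]_w ((state i (m + r) w - state i m w) ^+ 2)%:E <= (nu (i + m))%:E)%E.
Proof.
have mphi : measurable_fun setT (fun y : F * F => ((f y.1 - f y.2) ^+ 2)%:E).
  apply/measurable_EFinP/measurable_funX/measurable_funB.
    exact: (measurableT_comp mf measurable_fst).
  exact: (measurableT_comp mf measurable_snd).
have := integral_chain_pair mg x0 iidU i m r mphi
  (fun y => _ : 0 <= ((f y.1 - f y.2) ^+ 2)%:E)%E.
move=> -> /=; last by move=> y; rewrite lee_fin sqr_ge0.
by have := nu_bound (i + m) r; rewrite unlock.
Qed.

(** The mean at time [j + r] is also that of [f(X_{j,r})], so the difference is the mean of a
    variable whose [L^2] norm is at most [sqrt (nu j)]. *)
Lemma dist_mean_state (j r : nat) :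
  `|mean_state (j + r) - mean_state j| <= Num.sqrt (nu j).
Proof.
have h := @norm_integral_le _ _ _ P (fun w => state j r w - state j 0 w) (Num.sqrt (nu j)).
have mX : measurable_fun setT (fun w => state j r w - state j 0 w).
  by apply: measurable_funB; exact: measurable_state.
have s0 : 0 < Num.sqrt (nu j) by rewrite sqrtr_gt0.
have := h s0 mX; rewrite sqr_sqrtr ?(ltW (nu_gt0 _))//.
have := integral_sqr_state_sub j 0 r; rewrite add0n addn0 => h2 /(_ h2).
under eq_integral do rewrite EFinB.
rewrite integralB_EFin//; [|exact: integrable_state|exact: integrable_state].
by rewrite !integral_state addn0 -EFinB /= lee_fin.
Qed.

Section level.
Variables (b : nat -> nat) (k : nat).
Hypothesis hb : (2 * b k <= k)%N.

Local Notation fk := (fkl g x0 U f b k).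

Lemma integrable_fkl l : P.-integrable setT (EFin \o fk l).
Proof.
rewrite (_ : _ \o _ = (fun w => ((k - b k)%:R^-1)%:E *
    \sum_(b k <= i < k) (state i (k * (2 ^ l - 1)) w)%:E)%E).
  apply: integrableZl => //; apply: integrable_sum => // i _.
  exact: integrable_state.
by apply/funext => w; rewrite /= sumEFin -EFinM.
Qed.

Lemma integral_fkl l : (\int[P]_w (fk l w)%:E = ((k - b k)%:R^-1 *
  \sum_(b k <= i < k) mean_state (i + k * (2 ^ l - 1)))%:E)%E.
Proof.
transitivity (\int[P]_w (((k - b k)%:R^-1)%:E *
    \sum_(b k <= i < k) (state i (k * (2 ^ l - 1)) w)%:E)%E)%E.
  by apply: eq_integral => w _; rewrite sumEFin -EFinM.
rewrite integralZl//; last first.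
  by apply: integrable_sum => // i _; exact: integrable_state.
rewrite integral_sum//; last by move=> i; exact: integrable_state.
under eq_bigr do rewrite integral_state.
by rewrite sumEFin -EFinM.
Qed.

(** As [2^(l+1) - 1 = (2^l - 1) + 2^l], the chain in level [l + 1] starts [k 2^l] steps before that
    of level [l], and [integral_sqr_state_sub] bounds each summand. *)
Lemma integral_sqr_fkl_sub l : (\int[P]_w ((fk l.+1 w - fk l w) ^+ 2)%:E <=
  (mean_sqrt_nu nu k (b k) l ^+ 2)%:E)%E.
Proof.
have E w : fk l.+1 w - fk l w = (k - b k)%:R^-1 * \sum_(b k <= i < k)
    (state i (k * (2 ^ l - 1) + k * 2 ^ l) w - state i (k * (2 ^ l - 1)) w).
  rewrite /fkl -mulrBr sumrB; congr (_ * (_ - _)); apply: eq_bigr => i _.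
  rewrite -mulnDr expnS mul2n -addnn -addnBAC ?expn_gt0//.
under eq_integral do rewrite E.
apply: integral_sqr_sum_le => [i|i|i].
- by rewrite sqrtr_gt0.
- by apply: measurable_funB; exact: measurable_state.
- by rewrite sqr_sqrtr ?(ltW (nu_gt0 _))//; exact: integral_sqr_state_sub.
Qed.

Hypotheses (hk : (0 < k)%N) (nu_decr : forall i j, (i <= j)%N -> nu j <= nu i).
Hypothesis nu_sum : cvgn (series (nu_term nu)).

Lemma cvg_mean_state : mean_state n @[n --> \oo] --> limn mean_state.
Proof.
have : cvgn mean_state.
  by apply: (cvg_of_tail_bound (cvg_sqrt_nu nu_gt0 nu_decr nu_sum)); exact: dist_mean_state.
exact.
Qed.

(** A finite average of shifts of [mean_state] whose indices all tend to infinity with [l]. *)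
Lemma cvg_mean_fkl :
  (k - b k)%:R^-1 * \sum_(b k <= i < k) mean_state (i + k * (2 ^ l - 1))
  @[l --> \oo] --> limn mean_state.
Proof.
rewrite [X in _ --> X](_ : _ = (k - b k)%:R^-1 * \sum_(b k <= i < k) limn mean_state).
  apply: cvgMl_tmp; apply: cvg_big => [|i _]; first exact: add_continuous.
  apply: (@cvg_comp _ _ _ (fun l => i + k * (2 ^ l - 1))%N mean_state _ \oo).
    apply/cvgnyPge => A; near=> l.
    apply: (@leq_trans l); first by near: l; exact: nbhs_infty_ge.
    have : (l < 2 ^ l)%N by exact: ltn_expl.
    by move: (2 ^ l)%N hk => x; nia.
  exact: cvg_mean_state.
rewrite sumr_const_nat -(mulr_natl (limn mean_state)) mulKf// pnatr_eq0 -lt0n subn_gt0.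
exact: ltn_bk.
Unshelve. all: by end_near. Qed.

(** * The randomized estimator [Zk] *)

Section randomized.
Variables (N : {RV P >-> nat}) (indN : independent_of_family N U).
Hypothesis pN : forall l, P (N @^-1` [set l]) = (pl nu k l)%:E.

Local Notation p := (pl nu k).
Local Notation Z := (Zk g x0 U f b p N k).
Local Notation h := (fun l w => fk l.+1 w - fk l w).

Let mh l : measurable_fun (setT : set (driving_type U)) (h l : driving_type U -> R).
Proof. by apply: measurable_funB; exact: driving_measurable_fkl. Qed.

Let p_gt0 l : 0 < p l. Proof. exact: pl_gt0. Qed.

Lemma integral_sqr_Zk_le : (\int[P]_w (Z w ^+ 2)%:E <=
  (k%:R^-1 * (20 * nubar nu (b k)./2 ^+ 2))%:E)%E.
Proof.
have mphi l : measurable_fun setT (fun x : R => (x / p l) ^+ 2).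
  by apply/measurable_funX/measurable_funM.
rewrite (ge0_integral_randomized indN pN mh mphi); last by move=> *; exact: sqr_ge0.
have term_ge0 l : (0 <= (p l)%:E * \int[P]_w ((h l w / p l) ^+ 2)%:E)%E.
  rewrite mule_ge0 ?lee_fin ?(ltW (p_gt0 _))//.
  by apply: integral_ge0 => w _; rewrite lee_fin sqr_ge0.
have term_le l : ((p l)%:E * \int[P]_w ((h l w / p l) ^+ 2)%:E <=
    (mean_sqrt_nu nu k (b k) l ^+ 2 / p l)%:E)%E.
  have -> : (\int[P]_w ((h l w / p l) ^+ 2)%:E =
      ((p l)^-1 ^+ 2)%:E * \int[P]_w (h l w ^+ 2)%:E)%E.
    rewrite -ge0_integralZl_EFin ?sqr_ge0//.
    - by apply: eq_integral => w _; rewrite exprMn mulrC EFinM.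
    - by move=> w _; rewrite lee_fin sqr_ge0.
    - apply/measurable_EFinP/measurable_funX.
      exact: (driving_measurable_fun (mh l)).
  (* The weight [p l] of the level cancels one of the two factors [p l] from the squared
     denominator. *)
  rewrite muleA -EFinM (_ : p l * _ = (p l)^-1); last first.
    by field; rewrite gt_eqF.
  rewrite [X in (_ <= X%:E)%E]mulrC EFinM; apply: lee_wpmul2l.
    by rewrite lee_fin invr_ge0 ltW.
  exact: integral_sqr_fkl_sub.
apply: lime_le; first exact: is_cvg_nneseries.
near=> n; apply: (@le_trans _ _ (\sum_(0 <= l < n.+2)
    (p l)%:E * \int[P]_w ((h l w / p l) ^+ 2)%:E)%E).
  rewrite [leRHS](@big_cat_nat _ _ _ n)//=; last by rewrite (leq_trans (leqnSn _)).
  by rewrite leeDl// sume_ge0.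
apply: (le_trans (lee_sum _ (fun l _ => term_le l))).
rewrite sumEFin lee_fin ler_pdivlMl ?ltr0n// mulr_sumr.
under eq_bigr do rewrite mulrA.
exact: sum_mean_sqrt_nu_le.
Unshelve. all: by end_near. Qed.

(** The finite second moment yields this, and it is what allows the signed integral of [Z] to be
    split over the levels in [integral_Zk]. *)
Lemma integrable_Zk : P.-integrable setT (EFin \o Z).
Proof.
apply: integrable_of_sqr; last by rewrite (le_lt_trans integral_sqr_Zk_le)// ltry.
have mphi l : measurable_fun setT (fun x : R => x / p l) by exact: measurable_funM.
exact: (measurable_randomized N mh mphi).
Qed.

Lemma integral_Zk : (\int[P]_w (fk 0 w)%:E + \int[P]_w (Z w)%:E =
  (limn mean_state)%:E)%E.
Proof.
have mphi l : measurable_fun setT (fun x : R => x / p l) by exact: measurable_funM.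
have ih l : P.-integrable setT (fun w => (h l w)%:E).
  under eq_fun do rewrite EFinB.
  by apply: integrableB => //; exact: integrable_fkl.
have ihp l : P.-integrable setT (fun w => (h l w / p l)%:E).
  by under eq_fun do rewrite EFinM; exact: integrableZr.
rewrite (integral_randomized indN pN mh mphi integrable_Zk ihp).
(* The mean of [fk l]. The weights [p l] cancel, the series telescopes to the limit minus [e 0], and
   the mean of [fk 0] restores [e 0]. *)
pose e l := (k - b k)%:R^-1 * \sum_(b k <= i < k) mean_state (i + k * (2 ^ l - 1)).
have term l : ((p l)%:E * \int[P]_w (h l w / p l)%:E = (e l.+1 - e l)%:E)%E.
  under eq_integral do rewrite EFinM.
  rewrite integralZr// muleCA -EFinM divff ?gt_eqF// mule1.
  under eq_integral do rewrite EFinB.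
  rewrite integralB_EFin//; [|exact: integrable_fkl|exact: integrable_fkl].
  by rewrite !integral_fkl -EFinB.
under eq_eseriesr do rewrite term.
rewrite integral_fkl -/(e 0%N).
have c : (fun n => \sum_(0 <= l < n) (e l.+1 - e l)%:E)%E @ \oo -->
    (limn mean_state - e 0%N)%:E.
  under eq_fun do rewrite sumEFin telescope_sumr//.
  apply: cvg_EFin; first exact: nearW.
  by apply: cvgB; [exact: cvg_mean_fkl|exact: cvg_cst].
by rewrite (cvg_lim _ c)// -EFinD addrC subrK.
Qed.

End randomized.
End level.
End estimator.

Theorem lemma3p3 (R : realType) (d d1 d2 : measure_display)
  (T : measurableType d) (F : measurableType d1) (F' : measurableType d2)
  (P : probability T R)
  (g : F * F' -> F) (mg : measurable_fun setT g)
  (U : int -> {RV P >-> F'}) (iidU : iid U)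
  (x0 : F) (f : F -> R) (mf : measurable_fun setT f)
  (f_L2 : forall i : nat, f \o chain g x0 U i%:Z 0 \in Lfun P 2%:E)
  (b : nat -> nat) (hb : forall k, (1 <= k)%N -> (2 * b k <= k)%N)
  (tau : nat -> nat -> R)
  (htau : forall k l, (1 <= k)%N -> 0 <= tau k l <= cost k l.+1 + cost k l)
  (nu : nat -> R) (nu_gt0 : forall i, 0 < nu i)
  (nu_decr : forall i j, (i <= j)%N -> nu j <= nu i)
  (nu_sum : cvgn (series (nu_term nu)))
  (nu_bound : forall i m : nat,
    ('E_P[fun w => ((f (chain g x0 U i%:Z m%:Z w)
                    - f (chain g x0 U i%:Z 0 w)) ^+ 2)%R] <= (nu i)%:E)%E)
  (k : nat) (hk : (1 <= k)%N) :
  positive_distribution (pl nu k) /\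
  (expected_time (pl nu k) tau k <= (9 * k%:R)%R%:E)%E /\
  exists mu : R,
    'E_P[fun w => f (chain g x0 U h%:Z 0 w)]%E @[h --> \oo] --> mu%:E /\
    forall N : {RV P >-> nat},
      independent_of_family N U ->
      (forall l : nat, P (N @^-1` [set l]) = (pl nu k l)%:E) ->
      'E_P[fun w => (fkl g x0 U f b k 0 w + Zk g x0 U f b (pl nu k) N k w)%R]%E
        = mu%:E /\
      (k%:R%:E * 'E_P[fun w => ((Zk g x0 U f b (pl nu k) N k w) ^+ 2)%R]
        <= (20 * nubar nu (b k)./2 ^+ 2)%R%:E)%E.
Proof.
have hbk := hb k hk.
split; first exact: pl_distribution.
split; first by apply: expected_time_le => // l; exact: htau.
pose ms := mean_state (P := P) g U x0 f.
have c : ms n @[n --> \oo] --> limn ms by exact: (cvg_mean_state mg iidU mf f_L2 nu_gt0 nu_bound).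
exists (limn ms); split.
  have E h : 'E_P[fun w => f (chain g x0 U h%:Z 0 w)]%E = (ms h)%:E.
    by rewrite unlock (integral_state mg iidU mf f_L2 h 0) addn0.
  under eq_fun do rewrite E.
  by apply: cvg_EFin; [exact: nearW|exact: c].
move=> N indN pN.
have iZ := integrable_Zk mg iidU mf nu_gt0 nu_bound hbk hk nu_decr nu_sum indN pN.
have Z2 := integral_sqr_Zk_le mg iidU mf nu_gt0 nu_bound hbk hk nu_decr nu_sum indN pN.
split; rewrite unlock.
  under eq_integral do rewrite EFinD.
  rewrite integralD_EFin//; last exact: (integrable_fkl mg iidU mf f_L2).
  exact: (integral_Zk mg iidU mf f_L2 nu_gt0 nu_bound hbk hk nu_decr nu_sum indN pN).
have k0 : (0 <= k%:R%:E :> \bar R)%E by rewrite lee_fin.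
apply: (le_trans (lee_wpmul2l k0 Z2)).
by rewrite -EFinM mulVKf// pnatr_eq0 -lt0n.
Qed.
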